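(* Every branchwise-real tree order containing at most countably many branching nodes is continuously gradable.
   Context: A tree order is a partial order with a minimum element (root) such that for every $x$ the set $\{y\mid y\le x\}$ is linearly ordered; a branch is a maximal linearly ordered subset. A branchwise-real tree order is a tree order in which every branch is order-isomorphic to a real interval and any two elements have a greatest lower bound. For $x\in X$, the $x$-connected components are the equivalence classes of $\{y\mid y>x\}$ under $y\sim_x z$ iff there is $w>x$ with $w\le y,z$; $x$ is a branching node if there is more than one $x$-connected component. $X$ is continuously gradable if there is a strictly monotonic $\ell\colon X\to\mathbb{R}$ such that for all $x<y$ the restriction of $\ell$ to $[x,y]=\{z\mid x\le z\le y\}$ is an order-isomorphism onto $[\ell(x),\ell(y)]$. *)

(* Defs.v *)
From mathcomp Require Import all_boot all_order all_algebra.
From mathcomp Require Import all_classical all_reals all_analysis.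

Set Implicit Arguments.
Unset Strict Implicit.
Unset Printing Implicit Defensive.

Local Open Scope classical_set_scope.
Local Open Scope order_scope.

(* The underlying partial order is a porderType: classically, any partial order
   on any type is one. *)

Definition order_iso_on (d d' : Order.disp_t) (X : porderType d)
    (Y : porderType d') (f : X -> Y) (A : set X) (B : set Y) : Prop :=
  f @` A = B /\ {in A &, {mono f : x y / x <= y}}.

Definition chain_set (d : Order.disp_t) (X : porderType d) (C : set X) : Prop :=
  total_on C <=%O.

Definition tree_order (d : Order.disp_t) (X : porderType d) : Prop :=
  (exists r : X, forall x, r <= x) /\
  forall x : X, chain_set [set y | y <= x].

Definition branch (d : Order.disp_t) (X : porderType d) (B : set X) : Prop :=
  chain_set B /\ forall C : set X, chain_set C -> B `<=` C -> C = B.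

(* Intervals may be bounded or not, open or closed at either end, and reduced
   to a point: the one-element tree has a one-point branch. *)
Definition branchwise_real (R : realType) (d : Order.disp_t)
    (X : porderType d) : Prop :=
  [/\ tree_order X,
      forall B : set X, branch B ->
        exists (f : X -> R) (I : set R), is_interval I /\ order_iso_on f B I
    & forall x y : X, infimums [set x; y] !=set0].

Definition same_component (d : Order.disp_t) (X : porderType d) (x y z : X)
    : Prop :=
  exists w, [/\ x < w, w <= y & w <= z].

Definition components (d : Order.disp_t) (X : porderType d) (x : X)
    : set (set X) :=
  [set C | exists2 y, x < y & C = [set z | x < z /\ same_component x y z]].

Definition branching_node (d : Order.disp_t) (X : porderType d) (x : X)
    : Prop :=
  exists C D, [/\ components x C, components x D & C <> D].

Definition continuously_gradable (R : realType) (d : Order.disp_t)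
    (X : porderType d) : Prop :=
  exists l : X -> R, {homo l : x y / x < y} /\
    forall x y : X, x < y -> order_iso_on l `[x, y] `[l x, l y].

(* Main.v *)
Require Import Defs.
From mathcomp Require Import all_boot all_order all_algebra.
From mathcomp Require Import all_classical all_reals all_analysis.
From mathcomp Require Import lra.

(* A strictly monotone function is a grading as soon as it is continuous along
   every segment below a point.  Let b_0, b_1, ... enumerate the branching nodes
   (or constantly the root, if there are none), and let T be the set of points
   lying below some b_n.  The function x |-> f_n (meet x b_n), with f_n a real
   parametrization of the segment below b_n rescaled into [0, 1], is monotone,
   continuous along segments and strictly monotone below b_n; the sum of these
   functions with weights 2^-n is therefore strictly monotone on T.  Above a
   point y outside T the tree does not branch, so the points comparable to y form
   a branch; measuring how far y is from T along that branch gives a second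
   function, which vanishes on T.  The sum of the two is a grading. *)

Set Implicit Arguments.
Unset Strict Implicit.
Unset Printing Implicit Defensive.

Import Order.TTheory GRing.Theory Num.Theory.
Import numFieldNormedType.Exports.

Local Open Scope classical_set_scope.
Local Open Scope ring_scope.
Local Open Scope order_scope.

(** * Monotone real functions and continuity *)

(** A jump would leave a gap in the range: if [k] exceeds [k t + e] somewhere, that value is
    attained, by monotonicity to the right of [t], and so bounds [k] near [t]; symmetrically for
    [k t - e]. *)
Lemma homo_interval_continuous (R : realType) (k : R -> R) :
  {homo k : s t / s <= t} -> is_interval (range k) -> continuous k.
Proof.
move=> hk ik t; apply/cvgrPdist_le => e e0.
have upper : \forall s \near t, k s <= k t + e.
  have [[s kts]|nex] := pselect (exists s, k t + e < k s).
    have [|v _ vE] := ik (k t) (k s) (imageT _ _) (imageT _ _) (k t + e).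
      by rewrite (ltW kts) lerDl ltW.
    have tv : t < v.
      by rewrite ltNge; apply/negP => /hk; rewrite vE gerDl leNgt e0.
    near=> s'; rewrite -vE; apply: hk; near: s'.
    exact: lt_le_nbhsl.
  apply: filterE => s; rewrite leNgt; apply/negP => kts.
  by apply: nex; exists s.
have lower : \forall s \near t, k t - e <= k s.
  have [[s kts]|nex] := pselect (exists s, k s < k t - e).
    have [|v _ vE] := ik (k s) (k t) (imageT _ _) (imageT _ _) (k t - e).
      by rewrite (ltW kts) gerBl ltW.
    have tv : v < t.
      by rewrite ltNge; apply/negP => /hk; rewrite vE lerBrDr gerDl leNgt e0.
    near=> s'; rewrite -vE; apply: hk; near: s'.
    exact: lt_le_nbhsr.
  apply: filterE => s; rewrite leNgt; apply/negP => kts.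
  by apply: nex; exists s.
near=> s; rewrite ler_distlC; apply/andP; split; by near: s.
Unshelve. all: by end_near. Qed.

Lemma continuous_range_interval (R : realType) (k : R -> R) :
  continuous k -> is_interval (range k).
Proof.
move=> ck; apply/connected_intervalP/connected_continuous_connected.
  exact/connected_intervalP.
exact: continuous_subspaceT.
Qed.

(** * Series dominated by a geometric series *)

Section Series.
Variables (R : realType) (T : Type) (u : nat -> T -> R).
Hypothesis u0 : forall n t, 0 <= u n t.
Hypothesis u1 : forall n t, u n t <= 2^-1 ^+ n.

Let S n t := \sum_(0 <= i < n) u i t.
Definition sum_series (t : T) : R := limn (series (fun n => u n t)).

Lemma is_cvg_sum_series t : cvgn (series (fun n => u n t)).
Proof.
apply: (@series_le_cvg _ _ (geometric 1 2^-1)) => // [n|n|].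
- by rewrite /= mul1r exprn_ge0.
- by rewrite /= mul1r.
- by apply: is_cvg_geometric_series; rewrite ger0_norm//; lra.
Qed.

Lemma partial_sum_le n t : S n t <= sum_series t.
Proof.
apply: nondecreasing_cvgn_le; last exact: is_cvg_sum_series.
by apply/nondecreasing_seqP => m; rewrite /series /= big_nat_recr//= lerDl.
Qed.

(* [S m t + 2 * 2^-1 ^+ m] is nonincreasing in [m]. *)
Lemma sum_series_le n t : sum_series t <= S n t + 2 * 2^-1 ^+ n.
Proof.
apply: limr_le; first exact: is_cvg_sum_series.
near=> m; have nm : (n <= m)%N by near: m; exists n.
suff : S m t + 2 * 2^-1 ^+ m <= S n t + 2 * 2^-1 ^+ n.
  by apply: le_trans; rewrite lerDl mulr_ge0// exprn_ge0.
rewrite -(subnKC nm); elim: (m - n)%N => [|j]; first by rewrite addn0.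
apply: le_trans; rewrite addnS /S big_nat_recr//= exprS.
by have := u1 (n + j) t; lra.
Unshelve. all: by end_near. Qed.

Lemma sum_series_homo s t : (forall n, u n s <= u n t) ->
  sum_series s <= sum_series t.
Proof. by move=> h; apply: lim_series_le => //; exact: is_cvg_sum_series. Qed.

(** All terms of the difference series are nonnegative, so its sum is at least the single gap at
    index [n]. *)
Lemma sum_series_lt s t n : (forall n, u n s <= u n t) -> u n s < u n t ->
  sum_series s < sum_series t.
Proof.
move=> h hn; rewrite -subr_gt0 /sum_series -limB; try exact: is_cvg_sum_series.
rewrite (@lt_le_trans _ _ (u n t - u n s)) ?subr_gt0//.
apply: limr_ge; first by apply: is_cvgB; exact: is_cvg_sum_series.
near=> m; have nm : (n < m)%N by near: m; exists n.+1.
rewrite /series /= !fctE /= -sumrB.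
rewrite (big_rem n) ?mem_index_iota//= lerDl sumr_ge0// => i _.
by rewrite subr_ge0.
Unshelve. all: by end_near. Qed.

End Series.

(** The tail bound [2 * 2^-1 ^+ n] does not depend on the point, so convergence is uniform and an
    [e / 3] argument applies. *)
Lemma continuous_sum_series (R : realType) (T : topologicalType)
    (u : nat -> T -> R) :
  (forall n t, 0 <= u n t) -> (forall n t, u n t <= 2^-1 ^+ n) ->
  (forall n, continuous (u n)) -> continuous (sum_series u).
Proof.
move=> u0 u1 cu t; apply/cvgrPdist_le => e e0.
have [n ne] : exists n, 2 * 2^-1 ^+ n < e / 3 :> R.
  have : \forall n \near \oo, `|2^-1 ^+ n : R| < e / 6.
    apply: cvgr0_norm_lt; last by lra.
    by apply: cvg_expr; rewrite ger0_norm//; lra.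
  move=> [n _ /(_ n (leqnn n))] /=; rewrite ger0_norm ?exprn_ge0// => h.
  by exists n; lra.
have cS : continuous (fun s => \sum_(0 <= i < n) u i s).
  by apply: continuous_big => [|i _]; [exact: add_continuous|exact: cu].
have e30 : 0 < e / 3 by lra.
have /cvgrPdist_lt/(_ _ e30) := cS t.
apply: filterS => s; rewrite ltr_distl => /andP[h1 h2].
have := partial_sum_le u0 u1 n t; have := partial_sum_le u0 u1 n s.
have := sum_series_le u0 u1 n t; have := sum_series_le u0 u1 n s.
by rewrite ler_distl => *; apply/andP; split; lra.
Qed.

(** * Paths onto segments and continuity along them *)

Section Trees.
Variables (R : realType) (d : Order.disp_t) (X : porderType d).
Implicit Types (x y z w b : X) (h f : X -> R).

Definition initial_segment y : set X := [set z | z <= y].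

(** [X] carries no topology, so continuity along the segment below [y] is tested through weakly
    monotone maps from the whole real line onto it. *)
Definition path_to y (p : R -> X) : Prop :=
  {homo p : s t / s <= t} /\ range p = initial_segment y.

Definition path_continuous h : Prop :=
  forall y p, path_to y p -> continuous (h \o p).

(** Zorn's lemma is applied to the sets [A] whose union with [C] is a chain, so that the union of an
    empty family qualifies too. *)
Lemma chain_set_extends_to_branch (C : set X) :
  chain_set C -> exists2 B, branch B & C `<=` B.
Proof.
move=> chC.
have [A [chA maxA]] : exists A, chain_set (C `|` A) /\
    forall B, A `<` B -> ~ chain_set (C `|` B).
  apply: (@Zorn_bigcup _ (fun A => chain_set (C `|` A))) => F FP totF.
  move=> x y [Cx|[D FD Dx]] [Cy|[E FE Ey]].
  - exact: chC.
  - by apply: (FP E FE); [left|right].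
  - by apply: (FP D FD); [right|left].
  - by have [DE|ED] := totF D E FD FE;
      [apply: (FP E FE)|apply: (FP D FD)]; right; auto.
exists (C `|` A); last exact: subsetUl.
split=> // D chD CAD; apply/seteqP; split => // x Dx; apply: contrapT => CAx.
apply: (maxA (C `|` D)); last first.
  by rewrite setUA setUid setUidr//; apply: subset_trans CAD; exact: subsetUl.
split; first by move=> a Aa; right; apply: CAD; right.
by move=> CDA; apply: CAx; right; apply: CDA; right.
Qed.

(** Surjectivity onto the real segment is the intermediate value theorem for [h \o p], with [p] a
    path to [y]. *)
Lemma path_continuous_gradable h :
  {homo h : x y / x < y} -> path_continuous h ->
  (forall y, exists p, path_to y p) -> tree_order X ->
  continuously_gradable R X.
Proof.
move=> hlt hc hp [_ lin]; exists h; split=> // x y xy.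
have tot z w : z <= y -> w <= y -> (z <= w) \/ (w <= z).
  exact: lin.
have hle z w : z <= w -> h z <= h w.
  by rewrite le_eqVlt => /orP[/eqP->//|/hlt/ltW].
split; last first.
  move=> z w /[!inE] /andP[_ zy] /andP[_ wy].
  have [zw|] := tot z w zy wy; first by rewrite zw hle.
  rewrite le_eqVlt => /orP[/eqP->|wz]; first by rewrite !lexx.
  by rewrite (lt_geF wz) lt_geF// hlt.
apply/seteqP; split => [_ [z /andP[xz zy] <-]|v /=].
  by rewrite /= in_itv/= !hle.
rewrite in_itv/= => /andP[xv vy].
have [p pth] := hp y; have [_ py] := pth.
have ph z : z <= y -> range (h \o p) (h z).
  move=> zy; have : initial_segment y z by [].
  by rewrite -py => -[t _ <-]; exists t.
have [|t _ /= tv] := continuous_range_interval (hc y p pth)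
  (ph x (ltW xy)) (ph y (lexx y)) (z := v); first by rewrite xv vy.
have pty : p t <= y by have : range p (p t) by []; rewrite py.
(* This point is above [x]: otherwise [p t < x] would give [v < h x]. *)
exists (p t) => //=; rewrite in_itv/= pty andbT.
have [//|] := tot x (p t) (ltW xy) pty.
rewrite le_eqVlt => /orP[/eqP->//|/hlt].
by rewrite tv ltNge xv.
Qed.

(** [f] is only weakly monotone, so that it may be a parametrization preceded by a meet, which
    collapses points. *)
Lemma embedding_path_continuous f y p :
  {in initial_segment y &, {homo f : x z / x <= z}} ->
  is_interval (f @` initial_segment y) -> path_to y p -> continuous (f \o p).
Proof.
move=> hf fi [hp py]; have pty t : p t \in initial_segment y.
  by rewrite -py inE; exists t.
apply: homo_interval_continuous; last by rewrite -py image_comp in fi.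
by move=> s t st /=; apply: hf => //; exact: hp.
Qed.

(** A value between two values on the segment is attained in [B], and below [y] because [f] reflects
    the order. *)
Lemma order_iso_initial_segment (B : set X) (I : set R) f y :
  is_interval I -> order_iso_on f B I -> initial_segment y `<=` B ->
  is_interval (f @` initial_segment y).
Proof.
move=> iI [fB mf] yB _ _ [x xy <-] [z zy <-] v /andP[xv vz].
have : I v.
  apply: (iI (f x) (f z)); last by rewrite xv vz.
    by rewrite -fB; exists x => //; exact: yB.
  by rewrite -fB; exists z => //; exact: yB.
rewrite -fB => -[w Bw wv]; exists w => //=.
by apply: (le_trans _ zy); rewrite -mf ?wv// inE//; exact: yB.
Qed.

(** The meet [m] is strictly below both points; a witness that they share a component would be a
    lower bound strictly above [m]. *)
Lemma incomparable_inf_branching x y m : infimums [set x; y] m ->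
  ~ x <= y -> ~ y <= x -> branching_node m.
Proof.
move=> [lbm maxm] xy yx.
have mx : m <= x by apply: lbm; left.
have my : m <= y by apply: lbm; right.
have mltx : m < x.
  by rewrite lt_neqAle mx andbT; apply/eqP => mE; apply: xy; rewrite -mE.
have mlty : m < y.
  by rewrite lt_neqAle my andbT; apply/eqP => mE; apply: yx; rewrite -mE.
pose comp u := [set z | m < z /\ same_component m u z].
exists (comp x), (comp y); split; [by exists x|by exists y|move=> xyE].
have : comp x x by split=> //; exists x.
rewrite xyE => -[_ [w [mw wy wx]]].
have : w <= m by apply: maxm => _ [->|->].
by rewrite (lt_geF mw).
Qed.

(** * Segments and meets in a branchwise-real tree *)

Section BranchwiseReal.
Hypothesis hX : branchwise_real R X.

Let lin x : chain_set (initial_segment x).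
Proof. by case: hX => -[_ +] _ _; exact. Qed.

Let segment_embedding y : exists2 f : X -> R,
  {in initial_segment y &, {mono f : x z / x <= z}}
  & is_interval (f @` initial_segment y).
Proof.
have [B bB yB] := chain_set_extends_to_branch (@lin y).
have [_ br _] := hX; have [f [I [iI [fB mf]]]] := br B bB.
exists f.
  by move=> x z /[!inE] xy zy; apply: mf; rewrite inE; exact: yB.
exact: order_iso_initial_segment iI (conj fB mf) yB.
Qed.

Let r := projT1 (cid (proj1 (let: And3 h _ _ := hX in h))).
Let rP x : r <= x.
Proof. by rewrite /r; case: cid. Qed.

Lemma exists_path_to y : exists p, path_to y p.
Proof.
have [f mf fi] := segment_embedding y.
(* Clamping [t] between [f r] and [f y] puts it in the image of the segment, so that a preimage
   [p t] exists for every real [t]. *)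
pose clamp (t : R) := Num.max (f r) (Num.min t (f y)).
have ry : r \in initial_segment y by rewrite inE; exact: rP.
have yy : y \in initial_segment y by rewrite inE; exact: lexx.
have fry : f r <= f y by rewrite mf.
have clampP t : exists z, z <= y /\ f z = clamp t.
  have [|||z zy zt] := fi (f r) (f y) _ _ (clamp t); last by exists z.
  - by exists r => //; exact: set_mem.
  - by exists y => //; exact: set_mem.
  - by rewrite /clamp le_max lexx/= ge_max fry ge_min lexx orbT.
pose p t := projT1 (cid (clampP t)).
have pP t : p t <= y /\ f (p t) = clamp t by rewrite /p; case: cid.
exists p; split.
  move=> s t st; rewrite -mf ?inE; try exact: (pP _).1.
  rewrite !(pP _).2 /clamp ge_max le_max lexx/= le_max le_min !ge_min.
  by rewrite lexx st !orbT.
apply/seteqP; split => [_ [t _ <-]|z zy]; first exact: (pP t).1.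
exists (f z) => //.
have pz : f (p (f z)) = f z.
  rewrite (pP _).2 /clamp (min_idPl _) ?(max_idPr _)// mf// ?inE//.
by apply/eqP; rewrite eq_le -!mf ?inE//; try exact: (pP _).1; rewrite pz lexx.
Qed.

(* [m x] below is the meet of [x] and [b]; adding [1] to the denominator avoids
   a division by zero when [b] is the root. *)
Lemma truncated_grading b : exists h, [/\ {homo h : x y / x <= y},
  path_continuous h, forall x, 0 <= h x <= 1
  & forall x y, x < y -> y <= b -> h x < h y].
Proof.
have [f mf fi] := segment_embedding b; have [_ _ inf] := hX.
pose m x := projT1 (cid (inf x b)).
have mx x : m x <= x.
  by rewrite /m; case: cid => z [+ _] /=; apply; left.
have mb x : m x <= b.
  by rewrite /m; case: cid => z [+ _] /=; apply; right.
have mP x z : z <= x -> z <= b -> z <= m x.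
  by rewrite /m; case: cid => w [_ +] zx zb /=; apply => _ [->|->].
have mid x : x <= b -> m x = x.
  by move=> xb; apply/eqP; rewrite eq_le mx mP.
have mS x : m x \in initial_segment b by rewrite inE; exact: mb.
have rS : r \in initial_segment b by rewrite inE; exact: rP.
have bS : b \in initial_segment b by rewrite inE; exact: lexx.
have mhomo x y : x <= y -> m x <= m y.
  by move=> xy; apply: mP => //; apply: le_trans xy.
have D0 : 0 < 1 + (f b - f r).
  by rewrite ltr_wpDr// subr_ge0 mf.
exists (fun x => (f (m x) - f r) / (1 + (f b - f r))); split.
- move=> x y xy; rewrite ler_pM2r ?invr_gt0// lerD2r mf//; exact: mhomo.
- move=> y p yp t; apply: cvgM; last exact: cvg_cst.
  apply: cvgB; last exact: cvg_cst.
  apply: (@embedding_path_continuous (f \o m) y) => //.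
    by move=> x z _ _ xz /=; rewrite mf//; exact: mhomo.
  (* [m] maps the segment below [y] onto the one below [m y], because it fixes the points below
     [b]. *)
  have -> : (f \o m) @` initial_segment y = f @` initial_segment (m y).
    apply/seteqP; split=> [_ [z zy <-]|_ [z zy <-]].
      by exists (m z) => //; exact: mhomo.
    exists z; first exact: le_trans (mx y).
    by rewrite /= mid//; exact: le_trans (mb y).
  apply: (order_iso_initial_segment fi (conj erefl mf)) => z zy.
  exact: le_trans (mb y).
- move=> x; have frm : f r <= f (m x) by rewrite mf//; exact: rP.
  have fmb : f (m x) <= f b by rewrite mf.
  by rewrite ler_pdivlMr// ler_pdivrMr// mul0r mul1r; apply/andP; split; lra.
- move=> x y xy yb; rewrite ltr_pM2r ?invr_gt0// ltrD2r.
  have xb : x <= b by apply: le_trans (ltW xy) yb.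
  by rewrite !mid// (leW_mono_in mf) ?inE.
Qed.

(** * Grading the points outside a downward closed subtree *)

Section OutsideSubtree.
Variable T : set X.
Hypothesis T_down : forall x y, x <= y -> T y -> T x.
Hypothesis T_nonempty : T !=set0.
Hypothesis T_branching : forall x, branching_node x -> T x.

Let Tr : T r. Proof. by have [x] := T_nonempty; exact: T_down. Qed.

Let K y : set X := [set z | z >=< y].

Let initial_K y : initial_segment y `<=` K y.
Proof. by move=> z zy; rewrite /K/= /Order.comparable zy. Qed.

(** Two incomparable points above [y] would have a branching meet above [y]; it lies in [T], hence
    so would [y]. *)
Let K_chain y : ~ T y -> chain_set (K y).
Proof.
move=> nTy x z /orP[xy|yx] /orP[zy|yz].
- exact: (@lin y).
- by left; apply: le_trans yz.
- by right; apply: le_trans yx.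
have [xz|nxz] := pselect (x <= z); first by left.
have [zx|nzx] := pselect (z <= x); first by right.
have [_ _ inf] := hX; have [m mI] := inf x z; exfalso; apply: nTy.
apply: (@T_down _ m); last first.
  exact: T_branching (incomparable_inf_branching mI nxz nzx).
by apply: mI.2 => _ [->|->].
Qed.

Let K_branch y : ~ T y -> branch (K y).
Proof.
move=> nTy; split; first exact: K_chain.
move=> C chC KC; apply/seteqP; split => // z Cz.
apply/orP; apply: chC => //; apply: KC; exact: comparablexx.
Qed.

(* The parametrization attached to the branch [K y] is thus the same for all
   points outside [T] of a given segment. *)
Let K_eq y z : z <= y -> ~ T z -> K z = K y.
Proof.
move=> zy nTz; have nTy : ~ T y by move=> /(T_down zy).
apply/seteqP; split => x Kx; apply/orP.
  apply: (K_chain nTz) => //; rewrite /K/= /Order.comparable zy orbT//.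
by apply: (K_chain nTy) => //; exact: initial_K.
Qed.

(* The second alternative is needed when [T] accumulates at [y] without
   containing it, for then [h y = 0]. *)
Lemma outside_subtree_grading : exists h, [/\ {homo h : x y / x <= y},
  path_continuous h
  & forall x y, x < y -> ~ T y -> h x < h y \/ exists2 t, T t & x < t <= y].
Proof.
have [_ br _] := hX.
(* Choosing a parametrization per set, not per point, lets points of one branch share it; [0] is a
   dummy value for sets that are not branches. *)
have /choice[F FP] (B : set X) : exists f, branch B ->
    exists2 I : set R, is_interval I & order_iso_on f B I.
  have [bB|nbB] := pselect (branch B); last by exists (fun=> 0).
  by have [f [I [iI fI]]] := br B bB; exists f => _; exists I.
(* [s y] is the height at which the branch through [y] leaves [T]. *)
pose s y := sup (F (K y) @` (K y `&` T)).
pose h y := if pselect (T y) then 0 else F (K y) y - s y.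
have hT y : T y -> h y = 0 by move=> Ty; rewrite /h; case: pselect.
have mF y : ~ T y -> {in K y &, {mono F (K y) : x z / x <= z}}.
  by move=> /K_branch/FP[I _ []].
have Kxx y : y \in K y by rewrite inE; exact: comparablexx.
have iK y z : z <= y -> z \in K y by move=> zy; rewrite inE; exact: initial_K.
(* As [T] is downward closed, its points on the branch cannot lie above a point outside [T], so they
   lie below it. *)
have sub y : ~ T y -> forall z, ~ T z -> z <= y ->
    ubound (F (K y) @` (K y `&` T)) (F (K y) z).
  move=> nTy z nTz zy _ [t [Kt Tt] <-]; rewrite mF ?inE//.
    rewrite -(K_eq zy nTz) in Kt; case/orP: Kt => // /T_down.
    by move/(_ Tt).
  exact: initial_K.
(* A single formula, with [F (K y)] and [s y] fixed, describes [h] on the whole segment below [y];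
   monotonicity and continuity are read off from it. *)
have hE y z : ~ T y -> z <= y -> h z = Num.max 0 (F (K y) z - s y).
  move=> nTy zy; have [Tz|nTz] := pselect (T z).
    rewrite hT// max_l// subr_le0; apply: ub_le_sup.
      by exists (F (K y) y); exact: sub.
    by exists z => //; split=> //; exact: initial_K.
  rewrite max_r; first by rewrite /h; case: pselect => //; rewrite /s (K_eq zy).
  rewrite subr_ge0; apply: ge_sup; last exact: sub.
  by exists (F (K y) r), r => //; split=> //; apply: initial_K; exact: rP.
exists h; split.
- move=> x y xy; have [Ty|nTy] := pselect (T y).
    by rewrite !hT//; exact: T_down Ty.
  rewrite (hE y)// (hE y y)// ge_max le_max lexx/= le_max lerD2r mF//.
    by rewrite xy orbT.
  exact: iK.
- move=> y p yp; have [_ py] := yp.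
  have pty t : p t <= y by have : range p (p t) by []; rewrite py.
  have [Ty|nTy] := pselect (T y).
    have -> : h \o p = fun=> 0.
      by apply/funext => t /=; rewrite hT//; exact: T_down Ty.
    by move=> t; exact: cvg_cst.
  have -> : h \o p = (fun=> 0) \max (fun t => (F (K y) \o p) t - s y).
    by apply/funext => t /=; rewrite (hE y).
  move=> t; apply: continuous_max; first exact: cvg_cst.
  apply: cvgB; last exact: cvg_cst.
  apply: (@embedding_path_continuous _ y) => //.
    by move=> x z /[!inE] xy zy xz; rewrite mF//; exact: iK.
  have [I iI FI] := FP _ (K_branch nTy).
  exact: order_iso_initial_segment iI FI (@initial_K y).
- move=> x y xy nTy.
  have [[t Tt /andP[xt ty]]|nt] := pselect (exists2 t, T t & x < t <= y).
    by right; exists t => //; rewrite xt.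
  left; have Fxy : F (K y) x < F (K y) y.
    by rewrite (leW_mono_in (mF y nTy))//; exact: iK (ltW xy).
  (* The points of [T] on the branch lie below [y], hence below [x] since none is in between; so the
     maximum with [0] cannot hide the increase from [x] to [y]. *)
  have sx : s y <= F (K y) x.
    apply: ge_sup.
      by exists (F (K y) r), r => //; split=> //; apply: initial_K; exact: rP.
    move=> _ [t [Kt Tt] <-]; rewrite mF ?inE//; last exact: initial_K (ltW xy).
    have ty : t <= y by case/orP: Kt => // /T_down /(_ Tt).
    have [//|] := @lin y t x ty (ltW xy).
    rewrite le_eqVlt => /orP[/eqP->//|xt].
    by exfalso; apply: nt; exists t => //; rewrite xt.
  rewrite (hE y x nTy (ltW xy)) (hE y y)// lt_max; apply/orP; right.
  by rewrite gt_max subr_gt0 (le_lt_trans sx Fxy) ltrD2r.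
Qed.

End OutsideSubtree.

End BranchwiseReal.
End Trees.

(** * Adding the two gradings *)

Theorem theorem5p6 (R : realType) (d : Order.disp_t) (X : porderType d)
    (hX : branchwise_real R X)
    (hbranching : countable [set x : X | branching_node x]) :
  continuously_gradable R X.
Proof.
have [[[r _] _] _ _] := hX.
have [b bP] : exists b : nat -> X,
    forall x, branching_node x -> exists n, b n = x.
  have /countable_injP[e einj] := hbranching.
  (* [b] inverts the injection [e] on the branching nodes; the root fills the remaining indices. *)
  have /choice[b bP] n : exists y : X,
      forall x, branching_node x -> e x = n -> y = x.
    have [[y by_ ey]|ny] := pselect (exists2 y, branching_node y & e y = n).
      by exists y => x bx ex; apply: einj; rewrite ?inE// ex.
    by exists r => x bx ex; exfalso; apply: ny; exists x.
  by exists b => x bx; exists (e x); exact: bP.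
have /choice[phi phiP] n := truncated_grading hX (b n).
pose T := [set x | exists n, x <= b n].
have [|||g [ghomo gc gT]] := @outside_subtree_grading _ _ _ hX T.
- by move=> x y xy [n yn]; exists n; exact: le_trans yn.
- by exists (b 0%N), 0%N.
- by move=> x /bP[n <-]; exists n.
pose u n x := 2^-1 ^+ n * phi n x.
have w0 n : 0 < 2^-1 ^+ n :> R by rewrite exprn_gt0.
have u0 n x : 0 <= u n x.
  by have [_ _ /(_ x)/andP[? _] _] := phiP n; rewrite mulr_ge0// ltW.
have u1 n x : u n x <= 2^-1 ^+ n.
  by have [_ _ /(_ x)/andP[_ ?] _] := phiP n; rewrite ler_piMr// ltW.
have uhomo n x y : x <= y -> u n x <= u n y.
  by move=> xy; have [h _ _ _] := phiP n; rewrite ler_pM2l// h.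
have ult x y : x < y -> T y -> sum_series u x < sum_series u y.
  move=> xy [n yn]; apply: (sum_series_lt u0 u1 (n := n)).
    by move=> k; apply: uhomo; exact: ltW.
  by have [_ _ _ h] := phiP n; rewrite ltr_pM2l// h.
have ule x y : x <= y -> sum_series u x <= sum_series u y.
  by move=> xy; apply: (sum_series_homo u0 u1) => n; exact: uhomo.
apply: (@path_continuous_gradable _ _ _ (fun x => sum_series u x + g x)).
(* If [y] is in [T], the series is strict and [g] weak. Otherwise either [g] is strict, or the
   series increases strictly from [x] to [t] and weakly from [t] to [y]. *)
- move=> x y xy; have [Ty|nTy] := pselect (T y).
    by rewrite ltr_leD ?ult ?ghomo// ltW.
  have [gxy|[t Tt /andP[xt ty]]] := gT x y xy nTy.
    by rewrite ler_ltD// ule// ltW.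
  by rewrite ltr_leD ?ghomo ?(ltW xy)// (lt_le_trans (ult _ _ xt Tt))// ule.
- move=> y p yp t; apply: cvgD; last exact: gc yp t.
  apply: (@continuous_sum_series _ _ (fun n => u n \o p)) => [n z|n z|n z].
  - exact: u0.
  - exact: u1.
  - by apply: cvgM; [exact: cvg_cst|have [_ h _ _] := phiP n; exact: h yp z].
- exact: exists_path_to hX.
- by case: hX.
Qed.
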